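(* Let $(A,\circ)$ be a Novikov algebra, $(V,l_A,r_A)$ an $A$-bimodule and $\mathcal A=A\ltimes_{l_{A,\star}^*,-r_A^*}V^*$. Let $\alpha\in\mathrm{Hom}_{\mathbf k}(V,A)$ and $\check{\mathcal P}_-:=\check\alpha-\tau(\check\alpha)\in\mathcal A\otimes\mathcal A$. Put $$B_\alpha(u,v)=\alpha(u)\circ\alpha(v)-\alpha\big(l_A(\alpha(u))v+r_A(\alpha(v))u\big),\qquad u,v\in V.$$ Then $\check{\mathcal P}_-$ is a skew-symmetric solution of the generalized Novikov Yang-Baxter equations in $\mathcal A$ if and only if the following equalities hold for all $u,v,w\in V$ and $x\in A$: $$l_A(B_\alpha(u,v))w=l_A(B_\alpha(u,w))v,$$ $$l_A(B_\alpha(u,v))w-l_A(B_\alpha(v,u))w=r_A(B_\alpha(v,w))u-r_A(B_\alpha(u,w))v,$$ $$x\star B_\alpha(u,w)=B_\alpha(l_A(x)w,u)+B_\alpha(u,l_A(x)w),$$ $$B_\alpha(l_A(x)w,v)=B_\alpha(l_A(x)v,w),$$ $$B_\alpha(l_A(x)w,u)+B_\alpha(u,l_A(x)w)=x\circ B_\alpha(u,w)+B_\alpha(r_A(x)u,w),$$ $$B_\alpha(r_A(x)u,v)+B_\alpha(v,r_A(x)u)=B_\alpha(r_A(x)v,u)+B_\alpha(u,r_A(x)v).$$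
   Context: $\mathbf k$ is a field of characteristic zero; all vector spaces are finite-dimensional over $\mathbf k$. A Novikov algebra $(A,\circ)$ is a vector space with a bilinear operation satisfying $(a\circ b)\circ c-a\circ(b\circ c)=(b\circ a)\circ c-b\circ(a\circ c)$ and $(a\circ b)\circ c=(a\circ c)\circ b$ for all $a,b,c\in A$. Put $a\star b=a\circ b+b\circ a$, $L_A(a)b=a\circ b$, $R_A(a)b=b\circ a$, $L_{A,\star}=L_A+R_A$. An $A$-bimodule is $(V,l_A,r_A)$ with $l_A,r_A:A\to\mathrm{End}_{\mathbf k}(V)$ linear and, for all $a,b\in A,v\in V$: $l_A(a\circ b-b\circ a)v=l_A(a)l_A(b)v-l_A(b)l_A(a)v$; $l_A(a)r_A(b)v-r_A(b)l_A(a)v=r_A(a\circ b)v-r_A(b)r_A(a)v$; $l_A(a\circ b)v=r_A(b)l_A(a)v$; $r_A(a)r_A(b)v=r_A(b)r_A(a)v$. For linear $\varphi:A\to\mathrm{End}_{\mathbf k}(V)$, $\varphi^*:A\to\mathrm{End}_{\mathbf k}(V^* )$ is defined by $\langle\varphi^*(a)f,v\rangle=-\langle f,\varphi(a)v\rangle$. Put $l_{A,\star}=l_A+r_A$. The semi-direct product $\mathcal A=A\ltimes_{l_{A,\star}^*,-r_A^*}V^*$ is the Novikov algebra $A\oplus V^*$ with product $(a+f)\bullet(b+g)=a\circ b+l_{A,\star}^*(a)g-r_A^*(b)f$. For $\alpha\in\mathrm{Hom}_{\mathbf k}(V,A)$, $\check\alpha\in V^*\otimes A\subset\mathcal A\otimes\mathcal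 A$ is the tensor with $\langle\check\alpha,v\otimes a^*\rangle=\langle a^*,\alpha(v)\rangle$; $\tau$ is the flip. Generalized Novikov Yang-Baxter equations (GNYBES) in a Novikov algebra $(B,\circ)$: $r=\sum_i x_i\otimes y_i\in B\otimes B$ is a solution if for all $a\in B$ the following two equations hold (sums over $i,j$): $$\big(L_B(a)\otimes\mathrm{id}\otimes\mathrm{id}-\mathrm{id}\otimes L_B(a)\otimes\mathrm{id}\big)\big((\tau r)_{12}\circ r_{13}+r_{12}\circ r_{23}+r_{13}\star r_{23}\big)+\big((\mathrm{id}\otimes L_B(a)\otimes\mathrm{id})(r+\tau r)_{12}\big)\circ r_{23}-\big((L_B(a)\otimes\mathrm{id}\otimes\mathrm{id})r_{13}\big)\circ(r+\tau r)_{12}$$ $$+\big(\mathrm{id}\otimes\mathrm{id}\otimes L_{B,\star}(a)\big)\big(r_{23}\circ r_{13}-r_{13}\circ r_{23}-(\mathrm{id}\otimes\mathrm{id}\otimes\mathrm{id}-\tau\otimes\mathrm{id})(r_{13}\circ r_{12}+r_{12}\star r_{23})\big)=0,$$ $$(\mathrm{id}\otimes\mathrm{id}\otimes\mathrm{id}-\mathrm{id}\otimes\tau)(\mathrm{id}\otimes\mathrm{id}\otimes L_{B,\star}(a))\big(r_{13}\circ(\tau r)_{23}-r_{12}\star r_{23}-r_{13}\circ r_{12}\big)=0,$$ where $(\tau r)_{12}\circ r_{13}=\sum y_i\circ x_j\otimes x_i\otimes y_j$, $r_{12}\circ r_{23}=\sum x_i\otimes y_i\circ x_j\otimes y_j$,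 $r_{13}\star r_{23}=\sum x_i\otimes x_j\otimes y_i\star y_j$, $r_{13}\circ r_{23}=\sum x_i\otimes x_j\otimes y_i\circ y_j$, $r_{23}\circ r_{13}=\sum x_j\otimes x_i\otimes y_i\circ y_j$, $r_{13}\circ r_{12}=\sum x_i\circ x_j\otimes y_j\otimes y_i$, $r_{12}\star r_{23}=\sum x_i\otimes y_i\star x_j\otimes y_j$, $r_{13}\circ(\tau r)_{23}=\sum x_i\otimes y_j\otimes y_i\circ x_j$, $\big((\mathrm{id}\otimes L_B(a)\otimes\mathrm{id})(r+\tau r)_{12}\big)\circ r_{23}=\sum\big(x_i\otimes(a\circ y_i)\circ x_j\otimes y_j+y_i\otimes(a\circ x_i)\circ x_j\otimes y_j\big)$, $\big((L_B(a)\otimes\mathrm{id}\otimes\mathrm{id})r_{13}\big)\circ(r+\tau r)_{12}=\sum\big((a\circ x_i)\circ x_j\otimes y_j\otimes y_i+(a\circ x_i)\circ y_j\otimes x_j\otimes y_i\big)$. Equivalently (known fact): $r$ is a solution of the GNYBES in $B$ iff $B^*$ with the product $\langle a^*\circ_\Delta b^*,x\rangle=\langle a^*\otimes b^*,(L_B(x)\otimes\mathrm{id}+\mathrm{id}\otimes L_{B,\star}(x))r\rangle$ is a Novikov algebra. *)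

(* Defs.v *)
From HB Require Import structures.
From mathcomp Require Import all_boot all_order all_algebra.
From mathcomp Require Import ring.

Set Implicit Arguments.
Unset Strict Implicit.
Unset Printing Implicit Defensive.

Import GRing.Theory.
Local Open Scope ring_scope.

Reserved Notation "a ∘ b" (at level 39, left associativity).
Reserved Notation "a ⋆ b" (at level 39, left associativity).
Reserved Notation "x ⊗ y" (at level 40, left associativity).

Section Tensor.

Variable F : fieldType.
Implicit Types U W X : vectType F.

(* Model of U ⊗ W by the matrices of coordinates in the bases vbasis {:U} and
   vbasis {:W}; [tlift_pure] and [tens_ext] give its universal property. *)
Definition tens U W : vectType F := 'M[F]_(\dim {:U}, \dim {:W}).

Definition stdb U (i : 'I_(\dim {:U})) : U := (vbasis {:U})`_i.
Definition stdc U (u : U) (i : 'I_(\dim {:U})) : F := coord (vbasis {:U}) i u.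

Definition pure U W (u : U) (w : W) : tens U W :=
  \matrix_(i, j) (stdc u i * stdc w j).
Local Notation "x ⊗ y" := (pure x y) : ring_scope.

Lemma stdb_sum U (u : U) : u = \sum_i stdc u i *: stdb i.
Proof. exact: coord_vbasis (memvf u). Qed.

Lemma stdc_stdb U (i j : 'I_(\dim {:U})) : stdc (stdb i) j = (i == j)%:R.
Proof. exact: coord_free (basis_free (vbasisP {:U})). Qed.

Definition tlift_fun U W X (beta : U -> W -> X) (t : tens U W) : X :=
  \sum_i \sum_j (t : 'M_(_, _)) i j *: beta (stdb i) (stdb j).

Fact tlift_fun_linear U W X (beta : U -> W -> X) : linear (tlift_fun beta).
Proof.
move=> c s t; rewrite /tlift_fun scaler_sumr -big_split; apply: eq_bigr => i _.
rewrite scaler_sumr -big_split; apply: eq_bigr => j _ /=.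
by rewrite !mxE scalerDl scalerA.
Qed.

HB.instance Definition _ U W X (beta : U -> W -> X) :=
  GRing.isLinear.Build F (tens U W) X _ (tlift_fun beta)
    (tlift_fun_linear beta).

(* The linear map on U ⊗ W with x ⊗ y |-> beta x y; meaningful only when beta
   is bilinear. *)
Definition tlift U W X (beta : U -> W -> X) : 'Hom(tens U W, X) :=
  linfun (tlift_fun beta).

Lemma pure_linl U W (w : W) : linear (fun u : U => u ⊗ w).
Proof.
by move=> c u v; apply/matrixP => i j; rewrite !mxE /stdc linearP mulrDl mulrA.
Qed.

Lemma pure_linr U W (u : U) : linear (fun w : W => u ⊗ w).
Proof.
by move=> c v w; apply/matrixP => i j; rewrite !mxE /stdc linearP mulrDr mulrCA.
Qed.

Lemma tlift_pure U W X (beta : U -> W -> X)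
    (hl : forall w, linear (beta^~ w)) (hr : forall u, linear (beta u)) u w :
  tlift beta (u ⊗ w) = beta u w.
Proof.
pose bl w : {linear U -> X} := HB.pack (beta^~ w)
  (GRing.isLinear.Build F U X _ (beta^~ w) (hl w)).
pose br u : {linear W -> X} := HB.pack (beta u)
  (GRing.isLinear.Build F W X _ (beta u) (hr u)).
rewrite /tlift lfunE /= /tlift_fun.
rewrite -[RHS]/(bl w u) [in RHS](stdb_sum u) linear_sum; apply: eq_bigr => i _.
rewrite linearZ /= -[beta _ w]/(br (stdb i) w) [in RHS](stdb_sum w) linear_sum.
rewrite scaler_sumr; apply: eq_bigr => j _.
by rewrite linearZ /= scalerA mxE.
Qed.

Lemma tens_sum U W (t : tens U W) :
  t = \sum_i \sum_j (t : 'M_(_, _)) i j *: (stdb i ⊗ stdb j).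
Proof.
rewrite [LHS]matrix_sum_delta; apply: eq_bigr => i _; apply: eq_bigr => j _.
congr (_ *: _); apply/matrixP => k l.
by rewrite !mxE !stdc_stdb -natrM mulnb (eq_sym i) (eq_sym j).
Qed.

Lemma tens_ext U W X (f g : 'Hom(tens U W, X)) :
  (forall u w, f (u ⊗ w) = g (u ⊗ w)) -> f = g.
Proof.
move=> fg; apply/lfunP => t; rewrite (tens_sum t) !linear_sum.
apply: eq_bigr => i _; rewrite !linear_sum; apply: eq_bigr => j _.
by rewrite !linearZ /= fg.
Qed.

Definition tmap U U' W W' (f : 'Hom(U, U')) (g : 'Hom(W, W')) :
    'Hom(tens U W, tens U' W') := tlift (fun u w => f u ⊗ g w).

Definition flip U : 'End(tens U U) := tlift (fun x y : U => y ⊗ x).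

Definition tens3 U : vectType F := tens (tens U U) U.

Definition tmap3 U (f g h : 'End(U)) : 'End(tens3 U) := tmap (tmap f g) h.

(* τ ⊗ id and id ⊗ τ *)
Definition flip12 U : 'End(tens3 U) := tmap (flip U) \1%VF.
Definition flip23 U : 'End(tens3 U) :=
  tlift (fun (t : tens U U) (z : U) => tlift (fun x y : U => x ⊗ z ⊗ y) t).

(* For r = \sum_i x_i ⊗ y_i and phi linear in each argument, this is
   \sum_(i, j) phi x_i y_i x_j y_j; see [tsum2E]. *)
Definition tsum2 U X (r : tens U U) (phi : U -> U -> U -> U -> X) : X :=
  tlift (fun xi yi => tlift (phi xi yi) r) r.

Lemma tsum2E U X (phi : U -> U -> U -> U -> X) n (x y : 'I_n -> U)
    (h1 : forall b c d, linear (fun a => phi a b c d))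
    (h2 : forall a c d, linear (fun b => phi a b c d))
    (h3 : forall a b d, linear (fun c => phi a b c d))
    (h4 : forall a b c, linear (fun d => phi a b c d)) :
  tsum2 (\sum_i x i ⊗ y i) phi = \sum_i \sum_j phi (x i) (y i) (x j) (y j).
Proof.
have E a b : tlift (phi a b) (\sum_i x i ⊗ y i) = \sum_j phi a b (x j) (y j).
  by rewrite linear_sum; apply: eq_bigr => j _ /=; rewrite tlift_pure.
rewrite /tsum2 linear_sum; apply: eq_bigr => i _ /=; rewrite tlift_pure ?E //.
- move=> w c u v /=; rewrite !E scaler_sumr -big_split.
  by apply: eq_bigr => j _; rewrite h1.
- move=> w c u v /=; rewrite !E scaler_sumr -big_split.
  by apply: eq_bigr => j _; rewrite h2.
Qed.

End Tensor.

Notation "x ⊗ y" := (pure x y) : ring_scope.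

HB.mixin Record Vector_isNovikov (F : fieldType) A of Vector F A := {
  nmul : A -> A -> A;
  nmul_linl : forall b, linear (nmul^~ b);
  nmul_linr : forall a, linear (nmul a);
  nmul_lsym : forall a b c,
    nmul (nmul a b) c - nmul a (nmul b c) =
    nmul (nmul b a) c - nmul b (nmul a c);
  nmul_rcomm : forall a b c, nmul (nmul a b) c = nmul (nmul a c) b
}.

#[short(type="novikovType")]
HB.structure Definition Novikov (F : fieldType) :=
  {A of Vector_isNovikov F A & Vector F A}.

Notation "a ∘ b" := (nmul a b) : ring_scope.

Section NovikovTheory.

Variables (F : fieldType) (A : novikovType F).

Definition nstar (a b : A) : A := a ∘ b + b ∘ a.

Definition Lmul (a : A) : 'End(A) := linfun (fun b : A => a ∘ b).
Definition Rmul (a : A) : 'End(A) := linfun (fun b : A => b ∘ a).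
Definition Lstar (a : A) : 'End(A) := Lmul a + Rmul a.

HB.instance Definition _ (a : A) :=
  GRing.isLinear.Build F A A _ (nmul a) (nmul_linr a).

Lemma LmulE a b : Lmul a b = a ∘ b.
Proof. exact: lfunE. Qed.

Lemma RmulE a b : Rmul a b = b ∘ a.
Proof.
pose f : {linear A -> A} := HB.pack (fun b => nmul b a)
  (GRing.isLinear.Build F A A _ _ (nmul_linl a)).
exact: (lfunE f).
Qed.

Lemma LstarE a b : Lstar a b = nstar a b.
Proof. by rewrite /Lstar add_lfunE LmulE RmulE. Qed.

End NovikovTheory.

Notation "a ⋆ b" := (nstar a b) : ring_scope.

Section GNYBES.

Variables (F : fieldType) (B : novikovType F).

Definition gnybe1 (r : tens B B) (a : B) : tens3 B :=
  (tmap3 (Lmul a) \1%VF \1%VF - tmap3 \1%VF (Lmul a) \1%VF)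
    (tsum2 r (fun xi yi xj yj => yi ∘ xj ⊗ xi ⊗ yj)
     + tsum2 r (fun xi yi xj yj => xi ⊗ yi ∘ xj ⊗ yj)
     + tsum2 r (fun xi yi xj yj => xi ⊗ xj ⊗ yi ⋆ yj))
  + tsum2 r (fun xi yi xj yj =>
      xi ⊗ (a ∘ yi) ∘ xj ⊗ yj + yi ⊗ (a ∘ xi) ∘ xj ⊗ yj)
  - tsum2 r (fun xi yi xj yj =>
      (a ∘ xi) ∘ xj ⊗ yj ⊗ yi + (a ∘ xi) ∘ yj ⊗ xj ⊗ yi)
  + tmap3 \1%VF \1%VF (Lstar a)
      (tsum2 r (fun xi yi xj yj => xj ⊗ xi ⊗ yi ∘ yj)
       - tsum2 r (fun xi yi xj yj => xi ⊗ xj ⊗ yi ∘ yj)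
       - (\1%VF - flip12 B)
           (tsum2 r (fun xi yi xj yj => xi ∘ xj ⊗ yj ⊗ yi)
            + tsum2 r (fun xi yi xj yj => xi ⊗ yi ⋆ xj ⊗ yj))).

Definition gnybe2 (r : tens B B) (a : B) : tens3 B :=
  (\1%VF - flip23 B)
    (tmap3 \1%VF \1%VF (Lstar a)
      (tsum2 r (fun xi yi xj yj => xi ⊗ yj ⊗ yi ∘ xj)
       - tsum2 r (fun xi yi xj yj => xi ⊗ yi ⋆ xj ⊗ yj)
       - tsum2 r (fun xi yi xj yj => xi ∘ xj ⊗ yj ⊗ yi))).

Definition gnybes (r : tens B B) : Prop :=
  forall a : B, gnybe1 r a = 0 /\ gnybe2 r a = 0.

Definition skew_symmetric (r : tens B B) : Prop := flip B r = - r.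

End GNYBES.

Section Bimodules.

Variable F : fieldType.
Implicit Types (A : novikovType F) (V : vectType F).

Record bimodule A V := Bimodule {
  bl : {linear A -> 'End(V)};
  br : {linear A -> 'End(V)};
  bimod1 : forall (a b : A) (v : V),
    bl (a ∘ b - b ∘ a) v = bl a (bl b v) - bl b (bl a v);
  bimod2 : forall (a b : A) (v : V),
    bl a (br b v) - br b (bl a v) = br (a ∘ b) v - br b (br a v);
  bimod3 : forall (a b : A) (v : V), bl (a ∘ b) v = br b (bl a v);
  bimod4 : forall (a b : A) (v : V), br a (br b v) = br b (br a v)
}.

Definition dual V : vectType F := 'Hom(V, F^o).

Definition dual_end V (phi : 'End(V)) (f : dual V) : dual V :=
  - (f \o phi)%VF.

Fact dual_end_linear V (phi : 'End(V)) : linear (dual_end phi).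
Proof.
move=> c f g; apply/lfunP => v.
by rewrite /dual_end !(add_lfunE, scale_lfunE, opp_lfunE, comp_lfunE) opprD
  scalerN.
Qed.

HB.instance Definition _ V (phi : 'End(V)) :=
  GRing.isLinear.Build F (dual V) (dual V) _ (dual_end phi)
    (dual_end_linear phi).

Definition dual_rep A V (phi : {linear A -> 'End(V)}) (a : A) :
    'End(dual V) := linfun (dual_end (phi a)).

Lemma dual_repE A V (phi : {linear A -> 'End(V)}) a f v :
  dual_rep phi a f v = - f (phi a v).
Proof. by rewrite /dual_rep lfunE /= /dual_end opp_lfunE comp_lfunE. Qed.

Fact dual_rep_linear A V (phi : {linear A -> 'End(V)}) : linear (dual_rep phi).
Proof.
move=> c a b; apply/lfunP => f; apply/lfunP => v.
rewrite !(add_lfunE, scale_lfunE, dual_repE) linearP add_lfunE scale_lfunE.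
by rewrite linearP opprD scalerN.
Qed.

HB.instance Definition _ A V (phi : {linear A -> 'End(V)}) :=
  GRing.isLinear.Build F A 'End(dual V) _ (dual_rep phi) (dual_rep_linear phi).

Definition dual_bl A V (M : bimodule A V) : {linear A -> 'End(dual V)} :=
  dual_rep (bl M \+ br M).
Definition dual_br A V (M : bimodule A V) : {linear A -> 'End(dual V)} :=
  \- dual_rep (br M).

Lemma dual_blE A V (M : bimodule A V) a f v :
  dual_bl M a f v = - (f (bl M a v) + f (br M a v)).
Proof.
rewrite dual_repE -[X in - f X]/((bl M a + br M a)%R v).
by rewrite add_lfunE linearD.
Qed.

Lemma dual_brE A V (M : bimodule A V) a f v : dual_br M a f v = f (br M a v).
Proof.
by rewrite -[dual_br M a]/(- dual_rep (br M) a)%R !opp_lfunE dual_repE opprK.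
Qed.

Section DualBimodule.

Variables (A : novikovType F) (V : vectType F) (M : bimodule A V).

Let subE (f g : dual V) v : (f - g) v = f v - g v.
Proof. by rewrite add_lfunE opp_lfunE. Qed.

Let f1 (f : dual V) a b v : f (bl M (a ∘ b) v) - f (bl M (b ∘ a) v) =
  f (bl M a (bl M b v)) - f (bl M b (bl M a v)).
Proof.
have := bimod1 M a b v; rewrite [bl M (_ - _)]linearB add_lfunE opp_lfunE => E.
by rewrite -!linearB /= E.
Qed.

Let f2 (f : dual V) a b v : f (bl M a (br M b v)) =
  f (br M b (bl M a v)) + f (br M (a ∘ b) v) - f (br M b (br M a v)).
Proof. by rewrite -addrA -linearB /= -bimod2 linearB addrC subrK. Qed.

Fact dual_bimod1 (a b : A) (f : dual V) :
  dual_bl M (a ∘ b - b ∘ a) f =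
  dual_bl M a (dual_bl M b f) - dual_bl M b (dual_bl M a f).
Proof.
apply/lfunP => v; rewrite subE !dual_blE.
have /eqP := f1 f a b v; rewrite subr_eq => /eqP E.
rewrite [bl M (_ - _)]linearB [br M (_ - _)]linearB.
rewrite !(@add_lfunE _ V V) !(@opp_lfunE _ V V) !linearB /=.
rewrite !f2 E (bimod4 M a b); ring.
Qed.

Fact dual_bimod2 (a b : A) (f : dual V) :
  dual_bl M a (dual_br M b f) - dual_br M b (dual_bl M a f) =
  dual_br M (a ∘ b) f - dual_br M b (dual_br M a f).
Proof.
apply/lfunP => v; rewrite !subE !(dual_blE, dual_brE).
by rewrite !f2 (bimod4 M a b); ring.
Qed.

Fact dual_bimod3 (a b : A) (f : dual V) :
  dual_bl M (a ∘ b) f = dual_br M b (dual_bl M a f).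
Proof.
apply/lfunP => v; rewrite !(dual_blE, dual_brE).
by rewrite f2 bimod3 (bimod4 M a b); ring.
Qed.

Fact dual_bimod4 (a b : A) (f : dual V) :
  dual_br M a (dual_br M b f) = dual_br M b (dual_br M a f).
Proof. by apply/lfunP => v; rewrite !dual_brE bimod4. Qed.

(* V^* with left action (l + r)^* and right action - r^*; here phi^* is
   the representation dual_rep phi. *)
Definition dual_bimodule : bimodule A (dual V) :=
  Bimodule dual_bimod1 dual_bimod2 dual_bimod3 dual_bimod4.

End DualBimodule.

Definition semidirect A V (M : bimodule A V) : Type := (A * V)%type.

Section SemiDirect.

Variables (A : novikovType F) (V : vectType F) (M : bimodule A V).
Local Notation S := (semidirect M).

HB.instance Definition _ := Vector.copy S (A * V)%type.

Definition sd_mul (x y : S) : S :=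
  (x.1 ∘ y.1, bl M x.1 y.2 + br M y.1 x.2).

Let stdc_inj (v w : V) : (forall i, stdc v i = stdc w i) -> v = w.
Proof.
by move=> vw; rewrite (stdb_sum v) (stdb_sum w); apply: eq_bigr => i _;
  rewrite vw.
Qed.

Fact sd_mul_linl y : linear (sd_mul^~ y).
Proof.
move=> c x x'; congr (_, _); first by rewrite nmul_linl.
rewrite /= linearP add_lfunE scale_lfunE [br M _ _]linearP scalerDr.
exact: addrACA.
Qed.

Fact sd_mul_linr x : linear (sd_mul x).
Proof.
move=> c y y'; congr (_, _); first by rewrite nmul_linr.
rewrite /= [br M _]linearP add_lfunE scale_lfunE [bl M _ _]linearP scalerDr.
exact: addrACA.
Qed.

Fact sd_mul_lsym x y z :
  sd_mul (sd_mul x y) z - sd_mul x (sd_mul y z) =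
  sd_mul (sd_mul y x) z - sd_mul y (sd_mul x z).
Proof.
case: x y z => [a u] [b v] [c w]; congr (_, _); first exact: nmul_lsym.
rewrite /=; apply: stdc_inj => i.
have := congr1 (fun t : V => stdc t i) (bimod1 M a b w).
have := congr1 (fun t : V => stdc t i) (bimod2 M a c v).
have := congr1 (fun t : V => stdc t i) (bimod2 M b c u).
rewrite [bl M (_ - _)]linearB add_lfunE opp_lfunE /stdc.
rewrite !(linearB, linearD) /=.
move=> /eqP; rewrite subr_eq => /eqP ->; move=> /eqP; rewrite subr_eq => /eqP ->.
by move=> /eqP; rewrite subr_eq => /eqP ->; ring.
Qed.

Fact sd_mul_rcomm x y z :
  sd_mul (sd_mul x y) z = sd_mul (sd_mul x z) y.
Proof.
case: x y z => [a u] [b v] [c w]; congr (_, _); first exact: nmul_rcomm.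
rewrite /= !linearD /= !bimod3 (bimod4 M b c) !addrA.
by congr (_ + _); rewrite addrC.
Qed.

HB.instance Definition _ := Vector_isNovikov.Build F S
  sd_mul_linl sd_mul_linr sd_mul_lsym sd_mul_rcomm.

Definition sd_inl : 'Hom(A, S) := linfun (fun a : A => (a, 0) : S).
Definition sd_inr : 'Hom(V, S) := linfun (fun v : V => (0, v) : S).

Lemma sd_inlE a : sd_inl a = (a, 0) :> S.
Proof.
have h : linear (fun a : A => (a, 0) : S).
  by move=> c x y; congr (_, _); rewrite /= ?scaler0 ?addr0.
pose g : {linear A -> S} := HB.pack (fun a : A => (a, 0) : S)
  (GRing.isLinear.Build F A S _ _ h).
exact: (lfunE g).
Qed.

Lemma sd_inrE v : sd_inr v = (0, v) :> S.
Proof.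
have h : linear (fun v : V => (0, v) : S).
  by move=> c x y; congr (_, _); rewrite /= ?scaler0 ?addr0.
pose g : {linear V -> S} := HB.pack (fun v : V => (0, v) : S)
  (GRing.isLinear.Build F V S _ _ h).
exact: (lfunE g).
Qed.

End SemiDirect.

(* A ⋉ V^* for the actions (l + r)^* and - r^*. *)
Definition dual_semidirect A V (M : bimodule A V) : novikovType F :=
  semidirect (dual_bimodule M).

Lemma dual_semidirectE A V (M : bimodule A V) (a b : A) (f g : dual V) :
  ((a, f) : dual_semidirect M) ∘ (b, g) =
  (a ∘ b, dual_rep (bl M \+ br M) a g - dual_rep (br M) b f).
Proof. by congr (_, _ + _); rewrite /= opp_lfunE. Qed.

Section OOperator.

Variables (A : novikovType F) (V : vectType F).

(* <t, v ⊗ s> for t in V^* ⊗ A *)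
Definition tpair (t : tens (dual V) A) (v : V) (s : dual A) : F^o :=
  tlift (fun (f : dual V) (a : A) => f v * s a : F^o) t.

Definition stdb_dual (i : 'I_(\dim {:V})) : dual V :=
  linfun (fun v => stdc v i : F^o).

(* The element of V^* ⊗ A corresponding to alpha; characterized by
   [check_tensP], in view of [tpair_inj]. *)
Definition check_tens (alpha : 'Hom(V, A)) : tens (dual V) A :=
  \sum_i stdb_dual i ⊗ alpha (stdb i).

Lemma tpair_pure f a v s : tpair (f ⊗ a) v s = f v * s a.
Proof.
rewrite /tpair tlift_pure // => [w c x y|u c x y].
  by rewrite add_lfunE scale_lfunE mulrDl -mulrA.
by rewrite linearP mulrDr mulrCA.
Qed.

Lemma stdb_dualE i v : stdb_dual i v = stdc v i.
Proof.
have h : linear (fun v : V => stdc v i : F^o).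
  by move=> c x y; rewrite /stdc linearP.
pose g : {linear V -> F^o} := HB.pack (fun v : V => stdc v i : F^o)
  (GRing.isLinear.Build F V F^o _ _ h).
exact: (lfunE g).
Qed.

Lemma check_tensP alpha v s : tpair (check_tens alpha) v s = s (alpha v).
Proof.
rewrite [in RHS](stdb_sum v) !linear_sum /tpair linear_sum.
by apply: eq_bigr => i _; rewrite !linearZ /= -stdb_dualE; apply: tpair_pure.
Qed.

Lemma tpair_inj t t' : (forall v s, tpair t v s = tpair t' v s) -> t = t'.
Proof.
move=> tt'; apply/eqP; rewrite -subr_eq0; apply/eqP.
have d0 v s : tpair (t - t') v s = 0.
  by rewrite /tpair linearB /= -/(tpair t v s) tt' subrr.
move: (t - t') d0 => d d0; apply/matrixP => i j; rewrite mxE.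
pose s : dual A := linfun (fun a => coord (vbasis {:A}) j a : F^o).
have sE a : s a = stdc a j.
  have h : linear (fun a : A => stdc a j : F^o).
    by move=> c x y; rewrite /stdc linearP.
  pose g : {linear A -> F^o} := HB.pack (fun a : A => stdc a j : F^o)
    (GRing.isLinear.Build F A F^o _ _ h).
  exact: (lfunE g).
have : \sum_k (d : 'M_(_, _)) k j *: stdb k = 0 :> dual V.
  apply/lfunP => v; rewrite sum_lfunE zero_lfunE -[RHS](d0 v s).
  rewrite [in RHS](tens_sum d) /tpair linear_sum; apply: eq_bigr => k _.
  rewrite linear_sum (bigD1 j) //= big1 => [|l nlj].
    rewrite addr0 linearZ /= -[tlift _ _]/(tpair _ _ _) tpair_pure sE.
    by rewrite stdc_stdb eqxx mulr1 scale_lfunE.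
  rewrite linearZ /= -[tlift _ _]/(tpair _ _ _) tpair_pure sE.
  by rewrite stdc_stdb (negPf nlj) mulr0 scaler0.
move/(congr1 (fun f : dual V => stdc f i)).
rewrite /stdc linear0 linear_sum (bigD1 i) //= big1 => [|k nki].
  rewrite addr0 linearZ /= -/(stdc _ _) stdc_stdb eqxx => <-.
  by rewrite [RHS]mulr1.
by rewrite linearZ /= -/(stdc _ _) stdc_stdb (negPf nki) [LHS]mulr0.
Qed.

Definition obstr (M : bimodule A V) (alpha : 'Hom(V, A)) (u v : V) : A :=
  alpha u ∘ alpha v - alpha (bl M (alpha u) v + br M (alpha v) u).

Definition check_minus (M : bimodule A V) (alpha : 'Hom(V, A)) :
    tens (dual_semidirect M) (dual_semidirect M) :=
  let t := tmap (sd_inr (dual_bimodule M)) (sd_inl (dual_bimodule M))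
             (check_tens alpha) in
  t - flip (dual_semidirect M) t.

End OOperator.

End Bimodules.

(* Main.v *)
From HB Require Import structures.
Require Import Defs.
From mathcomp Require Import all_boot all_order all_algebra.
From mathcomp Require Import ring.

Set Implicit Arguments.
Unset Strict Implicit.
Unset Printing Implicit Defensive.

Import GRing.Theory.
Local Open Scope ring_scope.

(* For a skew-symmetric tensor r, both equations only involve the element
     N = r_13∘r_12 + r_12⋆r_23 + r_13∘r_23
   and its permutations: the second one says that L_⋆(a)_3 N is invariant under
   τ_23, and the first one that
     (L(a)_1 - L(a)_2) τ_23 N + L_⋆(a)_3 (1 - τ_12) N = 0.
   For the skew-symmetrization of the tensor of alpha, the only nonzero
   components of N, seen as maps on V x V, are B(u,v) in V^*⊗V^*⊗A,
   -(B(u,v) + B(v,u)) in V^*⊗A⊗V^* and B(v,u) in A⊗V^*⊗V^*. Taking a in A or in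
   V^* and comparing the components of the two equations gives linear
   combinations of the six identities. *)

(** * Linear forms on tensor products and contractions of tensors *)

Section Contractions.

Variable F : fieldType.
Implicit Types U W X Y : vectType F.

Lemma lfun_linearE U W (f : U -> W) (u : U) : linear f -> linfun f u = f u.
Proof.
move=> h; pose g : {linear U -> W} :=
  HB.pack f (GRing.isLinear.Build F U W _ f h).
exact: (lfunE g).
Qed.

Lemma lfunD U W (f : 'Hom(U, W)) u v : f (u + v) = f u + f v.
Proof. exact: linearD. Qed.

Lemma lfunN U W (f : 'Hom(U, W)) u : f (- u) = - f u.
Proof. exact: linearN. Qed.

Lemma lfun0 U W (f : 'Hom(U, W)) : f 0 = 0.
Proof. exact: linear0. Qed.

Lemma lfun_appD U W (f g : 'Hom(U, W)) u : (f + g) u = f u + g u.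
Proof. exact: add_lfunE. Qed.

Lemma lfun_appN U W (f : 'Hom(U, W)) u : (- f) u = - f u.
Proof. exact: opp_lfunE. Qed.

Lemma lfun_appB U W (f g : 'Hom(U, W)) u : (f - g) u = f u - g u.
Proof. by rewrite add_lfunE opp_lfunE. Qed.

Lemma dual_inj U (u u' : U) : (forall p : dual U, p u = p u') -> u = u'.
Proof.
move=> uu'; rewrite (stdb_sum u) (stdb_sum u'); apply: eq_bigr => i _.
by rewrite -!stdb_dualE uu'.
Qed.

Lemma dual_stdb U (f : dual U) : f = \sum_i f (stdb i) *: stdb_dual i.
Proof.
apply/lfunP => u; rewrite {1}(stdb_sum u) linear_sum sum_lfunE.
by apply: eq_bigr => i _; rewrite linearZ scale_lfunE stdb_dualE; apply: mulrC.
Qed.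

(** The form [p ⊗ q]. Such forms separate tensors by [teval_eq0], so tensor identities can be tested
    on them. *)
Definition teval U W (p : dual U) (q : dual W) : dual (tens U W) :=
  tlift (fun x y => p x * q y : F^o).

Lemma teval_pure U W (p : dual U) (q : dual W) x y :
  teval p q (x ⊗ y) = p x * q y.
Proof.
apply: tlift_pure => [w c u v|u c v w].
  by rewrite linearP mulrDl -mulrA.
by rewrite linearP mulrDr mulrCA.
Qed.

Lemma teval_tmap U U' W W' (f : 'Hom(U, U')) (g : 'Hom(W, W')) p q t :
  teval p q (tmap f g t) = teval (p \o f)%VF (q \o g)%VF t.
Proof.
rewrite -comp_lfunE; congr (fun_of_lfun _ t); apply: tens_ext => u w.
rewrite comp_lfunE /= tlift_pure ?teval_pure ?comp_lfunE //.
  by move=> y c u1 u2; rewrite linearP; apply: pure_linl.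
by move=> x c w1 w2; rewrite linearP; apply: pure_linr.
Qed.

Lemma flip_pure U (x y : U) : flip U (x ⊗ y) = y ⊗ x.
Proof. by apply: tlift_pure => w; [apply: pure_linr|apply: pure_linl]. Qed.

Lemma teval_flip U (p q : dual U) t : teval p q (flip U t) = teval q p t.
Proof.
rewrite -comp_lfunE; congr (fun_of_lfun _ t); apply: tens_ext => u w.
by rewrite comp_lfunE flip_pure !teval_pure mulrC.
Qed.

(** [tlift beta t] is by definition a linear combination of values of [beta] on pairs of basis
    vectors, and [g] preserves it whatever [beta] is. *)
Lemma tlift_linear U W X (beta : U -> W -> X) Y (g : 'Hom(X, Y)) t :
  g (tlift beta t) = tlift (fun x y => g (beta x y)) t.
Proof.
rewrite /tlift !lfunE /= /tlift_fun linear_sum; apply: eq_bigr => i _.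
by rewrite linear_sum; apply: eq_bigr => j _; rewrite linearZ.
Qed.

Lemma eq_tlift U W X (beta beta' : U -> W -> X) t :
  (forall x y, beta x y = beta' x y) -> tlift beta t = tlift beta' t.
Proof.
move=> E; rewrite /tlift !lfunE /= /tlift_fun; apply: eq_bigr => i _.
by apply: eq_bigr => j _; rewrite E.
Qed.

(** Pairing with two dual basis vectors reads off one entry of the coordinate matrix. *)
Lemma teval_eq0 U W (t : tens U W) : (forall p q, teval p q t = 0) -> t = 0.
Proof.
move=> t0; apply/matrixP => i j; rewrite mxE -(t0 (stdb_dual i) (stdb_dual j)).
rewrite /teval /tlift lfunE /= /tlift_fun (bigD1 i) //= (bigD1 j) //=.
rewrite !stdb_dualE !stdc_stdb !eqxx big1 => [|l nl]; last first.
  by rewrite !stdb_dualE !stdc_stdb (negPf nl) mulr0 scaler0.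
rewrite big1 => [|l nl]; last first.
  rewrite big1 // => m _.
  by rewrite !stdb_dualE !stdc_stdb (negPf nl) mul0r scaler0.
by rewrite !addr0 mulr1 [RHS]mulr1.
Qed.

Definition teval3 U (p q s : dual U) : dual (tens3 U) := teval (teval p q) s.

(** [teval_eq0] is used twice: for the last factor against the first two, then for the two-factor
    tensor left after contracting the last factor with [s]. *)
Lemma teval3_eq0 U (t : tens3 U) : (forall p q s, teval3 p q s t = 0) -> t = 0.
Proof.
move=> t0; apply: teval_eq0 => P s.
pose c : 'Hom(tens3 U, tens U U) := tlift (fun (x : tens U U) y => s y *: x).
have cE (Q : dual (tens U U)) : Q (c t) = teval Q s t.
  rewrite /c tlift_linear; apply: eq_tlift => x y.
  by rewrite linearZ; apply: mulrC.
by rewrite -cE [c t]teval_eq0 ?linear0 // => p q; rewrite cE t0.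
Qed.

Lemma teval3_pure U (p q s : dual U) x y z :
  teval3 p q s (x ⊗ y ⊗ z) = p x * q y * s z.
Proof. by rewrite /teval3 !teval_pure. Qed.

Lemma teval3_tmap3 U (f g h : 'End(U)) p q s t :
  teval3 p q s (tmap3 f g h t) =
  teval3 (p \o f)%VF (q \o g)%VF (s \o h)%VF t.
Proof.
rewrite /teval3 teval_tmap; congr (teval _ _ t).
by apply/lfunP => x; rewrite comp_lfunE teval_tmap.
Qed.

Lemma teval3_flip12 U (p q s : dual U) t :
  teval3 p q s (flip12 U t) = teval3 q p s t.
Proof.
rewrite /teval3 teval_tmap; congr (teval _ _ t).
  by apply/lfunP => x; rewrite comp_lfunE teval_flip.
by apply/lfunP => x; rewrite comp_lfunE id_lfunE.
Qed.

Lemma tens3_ext U X (f g : 'Hom(tens3 U, X)) :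
  (forall x y z, f (x ⊗ y ⊗ z) = g (x ⊗ y ⊗ z)) -> f = g.
Proof.
move=> fg; apply: tens_ext => t z.
pose m : 'Hom(tens U U, tens3 U) := linfun (fun t : tens U U => t ⊗ z).
have mE t' : m t' = t' ⊗ z by rewrite lfun_linearE //; apply: pure_linl.
rewrite -mE -!comp_lfunE; congr (fun_of_lfun _ t); apply: tens_ext => x y.
by rewrite !comp_lfunE mE fg.
Qed.

Lemma flip23_pure U (x y z : U) : flip23 U (x ⊗ y ⊗ z) = x ⊗ z ⊗ y.
Proof.
have E u u' v : tlift (fun x y : U => x ⊗ v ⊗ y) (u ⊗ u') = u ⊗ v ⊗ u'.
  apply: tlift_pure => [w c u1 u2|w]; last exact: pure_linr.
  by rewrite [_ ⊗ v]pure_linl; apply: pure_linl.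
rewrite /flip23 tlift_pure ?E // => [w c t t'|t c w w']; first exact: linearP.
(* Linearity in the inserted factor [z] is checked on the summands, as [tlift] is bundled as linear
   only in its tensor argument. *)
rewrite /tlift !lfunE /= /tlift_fun scaler_sumr -big_split.
apply: eq_bigr => i _.
rewrite scaler_sumr -big_split; apply: eq_bigr => j _ /=.
rewrite [stdb i ⊗ (_ + _)]pure_linr [_ ⊗ stdb j]pure_linl scalerDr.
by rewrite !scalerA mulrC.
Qed.

Lemma teval3_flip23 U (p q s : dual U) t :
  teval3 p q s (flip23 U t) = teval3 p s q t.
Proof.
rewrite -comp_lfunE; congr (fun_of_lfun _ t); apply: tens3_ext => x y z.
by rewrite comp_lfunE flip23_pure !teval3_pure mulrAC.
Qed.

Lemma tsum2_linear U X Y (g : 'Hom(X, Y)) (r : tens U U) phi :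
  g (tsum2 r phi) = tsum2 r (fun a b c d => g (phi a b c d)).
Proof.
by rewrite /tsum2 tlift_linear; apply: eq_tlift => a b; rewrite tlift_linear.
Qed.

(** A tensor seen as a map from the dual of [U] to [U]: [(p ⊗ id) r] here, [(id ⊗ p) r] for
    [contrr]. *)
Definition contrl U (r : tens U U) (p : dual U) : U :=
  tlift (fun x y => p x *: y) r.
Definition contrr U (r : tens U U) (p : dual U) : U :=
  tlift (fun x y => p y *: x) r.

Lemma dual_contrl U (r : tens U U) (p q : dual U) :
  q (contrl r p) = teval p q r.
Proof. by rewrite tlift_linear; apply: eq_tlift => x y; rewrite linearZ. Qed.

Lemma dual_contrr U (r : tens U U) (p q : dual U) :
  q (contrr r p) = teval q p r.
Proof.
by rewrite tlift_linear; apply: eq_tlift => x y; rewrite linearZ; apply: mulrC.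
Qed.

(** Contracting the right leg of [r] amounts to contracting the left leg of [τ r]. *)
Lemma contrr_skew U (r : tens U U) (p : dual U) :
  flip U r = - r -> contrr r p = - contrl r p.
Proof.
move=> skew; apply: dual_inj => q.
by rewrite dual_contrr linearN /= dual_contrl -teval_flip skew linearN.
Qed.

Lemma eq_tsum2 U X (r : tens U U) (phi phi' : U -> U -> U -> U -> X) :
  (forall a b c d, phi a b c d = phi' a b c d) -> tsum2 r phi = tsum2 r phi'.
Proof. by move=> E; apply: eq_tlift => a b; apply: eq_tlift => c d. Qed.

Lemma tsum2D U X (r : tens U U) (phi phi' : U -> U -> U -> U -> X) :
  tsum2 r (fun a b c d => phi a b c d + phi' a b c d)
  = tsum2 r phi + tsum2 r phi'.
Proof.
have D (f g : U -> U -> X) :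
    tlift (fun x y => f x y + g x y) r = tlift f r + tlift g r.
  rewrite /tlift !lfunE /= /tlift_fun -big_split; apply: eq_bigr => i _.
  by rewrite -big_split; apply: eq_bigr => j _ /=; rewrite scalerDr.
by rewrite /tsum2 -D; apply: eq_tlift => a b; apply: D.
Qed.

(** Each of the weights [p] and [q] depends on one copy of [r] only, so bilinearity of [b] moves the
    two sums into its two arguments. *)
Lemma tsum2_bilin U (r : tens U U) (b : U -> U -> F^o) (f g : U -> U -> U)
    (p q : U -> U -> F) :
  (forall v, linear (b^~ v)) -> (forall u, linear (b u)) ->
  tsum2 r (fun xi yi xj yj => p xi yi * q xj yj * b (f xi yi) (g xj yj) : F^o) =
  b (tlift (fun x y => p x y *: f x y) r) (tlift (fun x y => q x y *: g x y) r).
Proof.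
move=> hl hr.
pose bl v : 'Hom(U, F^o) := linfun (b^~ v).
pose br u : 'Hom(U, F^o) := linfun (b u).
have blE u v : bl v u = b u v by rewrite /bl lfun_linearE.
have brE u v : br u v = b u v by rewrite /br lfun_linearE.
rewrite -blE tlift_linear; apply: eq_tlift => xi yi; rewrite linearZ /= blE.
rewrite -brE tlift_linear.
(* The scalar is viewed as the linear map [p xi yi *: \1], so that [tlift_linear] also moves it
   under the sum. *)
rewrite -[RHS]/(p xi yi *: (id _)) -[X in p xi yi *: X]id_lfunE -scale_lfunE.
rewrite tlift_linear; apply: eq_tlift => xj yj.
by rewrite scale_lfunE id_lfunE linearZ /= brE -mulrA.
Qed.

End Contractions.

(** * The two equations evaluated on triples of linear forms *)

Section Evaluation.

Variables (F : fieldType) (B : novikovType F) (r : tens B B).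
Implicit Types (p q s : dual B) (a b c : B).
Local Notation T := (contrl r).
Local Notation T' := (contrr r).

Lemma mul_linl p a : linear (fun b => p (b ∘ a) : F^o).
Proof. by move=> c u v; rewrite nmul_linl linearP. Qed.

Lemma mul_linr p a : linear (fun b => p (a ∘ b) : F^o).
Proof. by move=> c u v; rewrite nmul_linr linearP. Qed.

Lemma nstar_linl a : linear (fun b => b ⋆ a).
Proof. by move=> c u v; rewrite /nstar nmul_linl nmul_linr scalerDr addrACA. Qed.

Lemma nstar_linr a : linear (nstar a).
Proof. by move=> c u v; rewrite /nstar nmul_linl nmul_linr scalerDr addrACA. Qed.

Lemma star_linl p a : linear (fun b => p (b ⋆ a) : F^o).
Proof. by move=> c u v; rewrite nstar_linl linearP. Qed.

Lemma star_linr p a : linear (fun b => p (a ⋆ b) : F^o).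
Proof. by move=> c u v; rewrite nstar_linr linearP. Qed.

Lemma lmul_linl p a c : linear (fun b => p ((a ∘ b) ∘ c) : F^o).
Proof. by move=> d u v; rewrite nmul_linr nmul_linl linearP. Qed.

(** In each term of the equations, one leg of each copy of [r] is paired with a form, giving the
    weights [p'] and [q']; the other two legs are multiplied and tested on the third form, giving
    [b]. *)
Lemma tsum2_teval3 (phi : B -> B -> B -> B -> tens3 B) p q s
    (b : B -> B -> F^o) (f g : B -> B -> B) (p' q' : B -> B -> F) :
  (forall v, linear (b^~ v)) -> (forall u, linear (b u)) ->
  (forall xi yi xj yj, teval3 p q s (phi xi yi xj yj) =
    p' xi yi * q' xj yj * b (f xi yi) (g xj yj)) ->
  teval3 p q s (tsum2 r phi) = b (tlift (fun x y => p' x y *: f x y) r)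
                                 (tlift (fun x y => q' x y *: g x y) r).
Proof.
by move=> hl hr E; rewrite tsum2_linear -tsum2_bilin //; apply: eq_tsum2.
Qed.

Hypothesis skew : skew_symmetric r.

(** The value of N at [p ⊗ q ⊗ s] once [T'] is replaced by [- T], which skew-symmetry allows. *)
Definition ybform p q s : F :=
  p (T s ∘ T q) - q (T p ⋆ T s) + s (T p ∘ T q).

Ltac bilin := move=> *; first
  [ exact: mul_linl | exact: mul_linr | exact: star_linl | exact: star_linr
  | exact: lmul_linl | rewrite teval3_pure; ring ].

(* Suffixes of ev_ name the term of the equations: tau for τ r, s for ⋆, and a
   for a factor modified by L(a). *)
Let ev_tau12_13 p q s :
  teval3 p q s (tsum2 r (fun xi yi xj yj => yi ∘ xj ⊗ xi ⊗ yj))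
  = p (T q ∘ T' s).
Proof.
apply: (tsum2_teval3 (b := fun u v => p (u ∘ v) : F^o)
  (f := fun _ y : B => y) (g := fun x _ : B => x)
  (p' := fun x _ => q x) (q' := fun _ y => s y)); bilin.
Qed.

Let ev_12_23 p q s :
  teval3 p q s (tsum2 r (fun xi yi xj yj => xi ⊗ yi ∘ xj ⊗ yj))
  = q (T p ∘ T' s).
Proof.
apply: (tsum2_teval3 (b := fun u v => q (u ∘ v) : F^o)
  (f := fun _ y : B => y) (g := fun x _ : B => x)
  (p' := fun x _ => p x) (q' := fun _ y => s y)); bilin.
Qed.

Let ev_13s23 p q s :
  teval3 p q s (tsum2 r (fun xi yi xj yj => xi ⊗ xj ⊗ yi ⋆ yj))
  = s (T p ⋆ T q).
Proof.
apply: (tsum2_teval3 (b := fun u v => s (u ⋆ v) : F^o)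
  (f := fun _ y : B => y) (g := fun _ y : B => y)
  (p' := fun x _ => p x) (q' := fun x _ => q x)); bilin.
Qed.

Let ev_a12_23 a p q s :
  teval3 p q s (tsum2 r (fun xi yi xj yj => xi ⊗ (a ∘ yi) ∘ xj ⊗ yj))
  = q ((a ∘ T p) ∘ T' s).
Proof.
apply: (tsum2_teval3 (b := fun u v => q ((a ∘ u) ∘ v) : F^o)
  (f := fun _ y : B => y) (g := fun x _ : B => x)
  (p' := fun x _ => p x) (q' := fun _ y => s y)); bilin.
Qed.

Let ev_atau12_23 a p q s :
  teval3 p q s (tsum2 r (fun xi yi xj yj => yi ⊗ (a ∘ xi) ∘ xj ⊗ yj))
  = q ((a ∘ T' p) ∘ T' s).
Proof.
apply: (tsum2_teval3 (b := fun u v => q ((a ∘ u) ∘ v) : F^o)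
  (f := fun x _ : B => x) (g := fun x _ : B => x)
  (p' := fun _ y => p y) (q' := fun _ y => s y)); bilin.
Qed.

Let ev_a13_12 a p q s :
  teval3 p q s (tsum2 r (fun xi yi xj yj => (a ∘ xi) ∘ xj ⊗ yj ⊗ yi))
  = p ((a ∘ T' s) ∘ T' q).
Proof.
apply: (tsum2_teval3 (b := fun u v => p ((a ∘ u) ∘ v) : F^o)
  (f := fun x _ : B => x) (g := fun x _ : B => x)
  (p' := fun _ y => s y) (q' := fun _ y => q y)); bilin.
Qed.

Let ev_a13_tau12 a p q s :
  teval3 p q s (tsum2 r (fun xi yi xj yj => (a ∘ xi) ∘ yj ⊗ xj ⊗ yi))
  = p ((a ∘ T' s) ∘ T q).
Proof.
apply: (tsum2_teval3 (b := fun u v => p ((a ∘ u) ∘ v) : F^o)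
  (f := fun x _ : B => x) (g := fun _ y : B => y)
  (p' := fun _ y => s y) (q' := fun x _ => q x)); bilin.
Qed.

Let ev_23_13 p q s :
  teval3 p q s (tsum2 r (fun xi yi xj yj => xj ⊗ xi ⊗ yi ∘ yj))
  = s (T q ∘ T p).
Proof.
apply: (tsum2_teval3 (b := fun u v => s (u ∘ v) : F^o)
  (f := fun _ y : B => y) (g := fun _ y : B => y)
  (p' := fun x _ => q x) (q' := fun x _ => p x)); bilin.
Qed.

Let ev_13_23 p q s :
  teval3 p q s (tsum2 r (fun xi yi xj yj => xi ⊗ xj ⊗ yi ∘ yj))
  = s (T p ∘ T q).
Proof.
apply: (tsum2_teval3 (b := fun u v => s (u ∘ v) : F^o)
  (f := fun _ y : B => y) (g := fun _ y : B => y)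
  (p' := fun x _ => p x) (q' := fun x _ => q x)); bilin.
Qed.

Let ev_13_12 p q s :
  teval3 p q s (tsum2 r (fun xi yi xj yj => xi ∘ xj ⊗ yj ⊗ yi))
  = p (T' s ∘ T' q).
Proof.
apply: (tsum2_teval3 (b := fun u v => p (u ∘ v) : F^o)
  (f := fun x _ : B => x) (g := fun x _ : B => x)
  (p' := fun _ y => s y) (q' := fun _ y => q y)); bilin.
Qed.

Let ev_12s23 p q s :
  teval3 p q s (tsum2 r (fun xi yi xj yj => xi ⊗ yi ⋆ xj ⊗ yj))
  = q (T p ⋆ T' s).
Proof.
apply: (tsum2_teval3 (b := fun u v => q (u ⋆ v) : F^o)
  (f := fun _ y : B => y) (g := fun x _ : B => x)
  (p' := fun x _ => p x) (q' := fun _ y => s y)); bilin.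
Qed.

Let ev_13_tau23 p q s :
  teval3 p q s (tsum2 r (fun xi yi xj yj => xi ⊗ yj ⊗ yi ∘ xj))
  = s (T p ∘ T' q).
Proof.
apply: (tsum2_teval3 (b := fun u v => s (u ∘ v) : F^o)
  (f := fun _ y : B => y) (g := fun x _ : B => x)
  (p' := fun x _ => p x) (q' := fun _ y => q y)); bilin.
Qed.

Let skewr p : T' p = - T p. Proof. exact: contrr_skew. Qed.

Let nmulNl a b : (- a) ∘ b = - (a ∘ b).
Proof. by rewrite -!RmulE lfunN. Qed.

Let nmulNr a b : a ∘ (- b) = - (a ∘ b).
Proof. by rewrite -!LmulE lfunN. Qed.

Let nstarNr a b : a ⋆ (- b) = - (a ⋆ b).
Proof. by rewrite -!LstarE lfunN. Qed.

Let comp_id p : (p \o \1)%VF = p.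
Proof. exact: comp_lfun1r. Qed.

(** The terms in [r + τ r] vanish by skew-symmetry. The first bracket takes the value
    [- ybform p s q], and the bracket under [Lstar a] the value [ybform q p s - ybform p q s]. *)
Lemma gnybe1_eval a p q s : teval3 p q s (gnybe1 r a) =
  ybform p s (q \o Lmul a)%VF - ybform (p \o Lmul a)%VF s q
  + ybform q p (s \o Lstar a)%VF - ybform p q (s \o Lstar a)%VF.
Proof.
rewrite /gnybe1 !tsum2D.
(* Hiding the tensors and the maps behind variables keeps the unifier from
   unfolding them to matrices. *)
have := ev_tau12_13; have := ev_12_23; have := ev_13s23.
have := ev_a12_23 a; have := ev_atau12_23 a; have := ev_a13_12 a.
have := ev_a13_tau12 a; have := ev_23_13; have := ev_13_23.
have := ev_13_12; have := ev_12s23.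
do 11! (move: (tsum2 _ _) => ?).
move=> e1 e2 e3 e4 e5 e6 e7 e8 e9 e10 e11.
have : forall p q s t, teval3 p q s ((\1%VF - flip12 B) t) =
    teval3 p q s t - teval3 q p s t.
  by move=> *; rewrite lfun_appB lfunD lfunN id_lfunE teval3_flip12.
have : forall p q s t,
    teval3 p q s ((tmap3 (Lmul a) \1 \1 - tmap3 \1 (Lmul a) \1)%VF t) =
    teval3 (p \o Lmul a)%VF q s t - teval3 p (q \o Lmul a)%VF s t.
  by move=> *; rewrite lfun_appB lfunD lfunN !teval3_tmap3 !comp_id.
have : forall p q s t, teval3 p q s (tmap3 \1 \1 (Lstar a) t) =
    teval3 p q (s \o Lstar a)%VF t.
  by move=> *; rewrite teval3_tmap3 !comp_id.
move: (tmap3 \1 \1 (Lstar a)) (_ - tmap3 _ _ _) (_ - flip12 B).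
move=> m1 m2 m3 E1 E2 E3.
rewrite !(lfunD, lfunN) !(E1, E2) !(lfunD, lfunN, E3).
rewrite !(e1, e2, e3, e4, e5, e6, e7, e8, e9, e10, e11) !skewr.
rewrite !(nmulNl, nmulNr, nstarNr) !lfunN !opprK /ybform /nstar !lfunD.
ring.
Qed.

(** The inner bracket takes the value [- ybform p q s]. *)
Lemma gnybe2_eval a p q s : teval3 p q s (gnybe2 r a) =
  ybform p s (q \o Lstar a)%VF - ybform p q (s \o Lstar a)%VF.
Proof.
rewrite /gnybe2; have := ev_13_tau23; have := ev_13_12; have := ev_12s23.
do 3! (move: (tsum2 _ _) => ?).
move=> e1 e2 e3.
have : forall p q s t, teval3 p q s ((\1%VF - flip23 B) t) =
    teval3 p q s t - teval3 p s q t.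
  by move=> *; rewrite lfun_appB lfunD lfunN id_lfunE teval3_flip23.
have : forall p q s t, teval3 p q s (tmap3 \1 \1 (Lstar a) t) =
    teval3 p q (s \o Lstar a)%VF t.
  by move=> *; rewrite teval3_tmap3 !comp_id.
move: (tmap3 \1 \1 (Lstar a)) (_ - flip23 B) => m1 m2 E1 E2.
rewrite E2 !E1 !(lfunD, lfunN) !(e1, e2, e3) !skewr !(nmulNl, nmulNr, nstarNr).
rewrite !lfunN !opprK /ybform /nstar !lfunD.
ring.
Qed.

Lemma gnybesP : gnybes r <->
  forall a p q s,
    ybform p s (q \o Lmul a)%VF + ybform q p (s \o Lstar a)%VF =
      ybform (p \o Lmul a)%VF s q + ybform p q (s \o Lstar a)%VF
    /\ ybform p s (q \o Lstar a)%VF = ybform p q (s \o Lstar a)%VF.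
Proof.
split=> [E a p q s|E a]; last split.
- have [/(congr1 (teval3 p q s))] := E a; rewrite gnybe1_eval lfun0 => E1.
  move=> /(congr1 (teval3 p q s)); rewrite gnybe2_eval lfun0 => /eqP.
  rewrite subr_eq0 => /eqP E2; split=> //.
  by apply/eqP; rewrite -subr_eq0 opprD addrA -E1; apply/eqP; ring.
- apply: teval3_eq0 => p q s; rewrite gnybe1_eval addrAC -addrA.
  have [E1 _] := E a p q s.
  rewrite -[RHS](subrr (ybform (p \o Lmul a)%VF s q
    + ybform p q (s \o Lstar a)%VF)).
  by rewrite -{1}E1; ring.
- by apply: teval3_eq0 => p q s; rewrite gnybe2_eval (E a p q s).2 subrr.
Qed.

End Evaluation.

(** * The skew-symmetrized tensor of [alpha] and the forms on the semi-direct product *)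

Section CheckMinus.

Variables (k : fieldType) (A : novikovType k) (V : vectType k).
Variables (M : bimodule A V) (alpha : 'Hom(V, A)).

Local Notation S := (dual_semidirect M).
Local Notation l := (bl M).
Local Notation r := (br M).
Local Notation B := (obstr M alpha).
Local Notation P := (check_minus M alpha).
Implicit Types (sg rh pi : dual A) (u v w : V) (x : A) (f : dual V).

(** Identifies the dual of [S] with the sum of the dual of [A] and [V], a vector of [V] acting on
    forms by evaluation. *)
Definition sdfun sg u : dual S :=
  linfun (fun z : S => sg (z : A * dual V).1 + (z : A * dual V).2 u : k^o).

Lemma sdfunE sg u x f : sdfun sg u ((x, f) : S) = sg x + f u.
Proof.
rewrite /sdfun lfun_linearE // => c [y g] [y' g'] /=.
by rewrite linearP add_lfunE scale_lfunE scalerDr addrACA.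
Qed.

Lemma sdfun_surj (p : dual S) : exists sg u, p = sdfun sg u.
Proof.
pose h f := p ((0, f) : S).
have hD c f g : h (c *: f + g) = c * h f + h g.
  rewrite -[RHS]/(c *: h f + h g) -linearP; congr (p _).
  by congr (_, _); rewrite /= scaler0 addr0.
(* By reflexivity of [V], the restriction [h] of [p] to the dual of [V] is evaluation at this
   vector, whose coordinates are the values of [h] on the dual basis. *)
exists (p \o sd_inl (dual_bimodule M))%VF, (\sum_i h (stdb_dual i) *: stdb i).
apply/lfunP => -[x f]; rewrite sdfunE comp_lfunE sd_inlE.
pose g : dual (dual V) := linfun (h : _ -> k^o).
have gE f' : g f' = h f' by rewrite lfun_linearE.
have -> : f (\sum_i h (stdb_dual i) *: stdb i) = h f.
  rewrite -gE {2}(dual_stdb f) !linear_sum; apply: eq_bigr => i _.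
  by rewrite !linearZ /= gE; apply: mulrC.
rewrite -linearD; congr (p _); by congr (_, _); rewrite /= ?addr0 ?add0r.
Qed.

Lemma check_minus_skew : skew_symmetric P.
Proof.
have ff (t : tens S S) : flip S (flip S t) = t.
  apply/eqP; rewrite -subr_eq0; apply/eqP; apply: teval_eq0 => p q.
  by rewrite lfunD lfunN !teval_flip subrr.
by rewrite /skew_symmetric /check_minus lfunD lfunN ff opprB.
Qed.

(** The tensor lies in the dual of [V] tensored with [A], so only the vector part of [p] and the
    [A]-part of [q] contribute. *)
Lemma teval_check (p q : dual S) sg u rh v : p = sdfun sg u -> q = sdfun rh v ->
  teval p q (tmap (sd_inr (dual_bimodule M)) (sd_inl (dual_bimodule M))
             (check_tens alpha)) = rh (alpha u).
Proof.
move=> -> ->; rewrite teval_tmap -(check_tensP alpha u rh); apply: eq_tlift => f x.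
congr (_ * _).
  by rewrite [LHS](comp_lfunE (sdfun sg u)) sd_inrE sdfunE lfun0 add0r.
by rewrite [LHS](comp_lfunE (sdfun rh v)) sd_inlE sdfunE zero_lfunE addr0.
Qed.

(** The tensor of [alpha] contributes the component in [A], and its flip, which enters with a minus
    sign, the component in the dual of [V]. *)
Lemma contrl_check_minus sg u :
  contrl P (sdfun sg u) = (alpha u, - (sg \o alpha)%VF) :> A * dual V.
Proof.
apply: (@dual_inj _ S) => q; have [rh [v ->]] := sdfun_surj q.
rewrite dual_contrl sdfunE opp_lfunE comp_lfunE /check_minus lfunD lfunN.
by rewrite teval_flip !(@teval_check _ _ _ _ _ _ erefl erefl).
Qed.

(** A matrix coefficient of [phi]; it appears when the component [f] of a multiplier acts on [A]. *)
Definition matcoef (phi : {linear A -> 'End(V)}) f u : dual A :=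
  linfun (fun x => f (phi x u) : k^o).

Lemma matcoefE phi f u x : matcoef phi f u x = f (phi x u).
Proof.
rewrite /matcoef lfun_linearE // => c y z.
by rewrite [phi _]linearP add_lfunE scale_lfunE linearP.
Qed.

Let dual_rep_starE x g u :
  dual_rep (bl M \+ br M) x g u = - (g (l x u) + g (r x u)).
Proof. exact: dual_blE. Qed.

Lemma sdfun_Lmul sg u x f :
  (sdfun sg u \o Lmul ((x, f) : S))%VF =
  sdfun (sg \o Lmul x + matcoef r f u)%VF (- (l x u + r x u)).
Proof.
apply/lfunP => -[b g]; rewrite comp_lfunE LmulE dual_semidirectE !sdfunE.
rewrite [in RHS]lfun_appD comp_lfunE LmulE matcoefE lfun_appB dual_rep_starE.
rewrite dual_repE lfunN lfunD.
ring.
Qed.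

(** In the symmetrized product the contributions of [r] cancel between the two actions, so only [l]
    survives outside [Lstar x]. *)
Lemma sdfun_Lstar sg u x f :
  (sdfun sg u \o Lstar ((x, f) : S))%VF =
  sdfun (sg \o Lstar x - matcoef l f u)%VF (- l x u).
Proof.
apply/lfunP => -[b g]; rewrite comp_lfunE LstarE /nstar !dual_semidirectE.
rewrite lfunD !sdfunE [in RHS]lfun_appB comp_lfunE LstarE /nstar lfunD.
rewrite matcoefE !lfun_appB !dual_rep_starE !dual_repE lfunN.
ring.
Qed.

(** The products in [A] give the terms [alpha u ∘ alpha v] of the obstructions; the components of
    the contractions in the dual of [V] give the terms under [alpha]. *)
Lemma ybform_check_minus sg u rh v pi w :
  ybform P (sdfun sg u) (sdfun rh v) (sdfun pi w) =
  sg (B w v) - rh (B u w + B w u) + pi (B u v).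
Proof.
rewrite /ybform !contrl_check_minus /nstar !dual_semidirectE lfunD !sdfunE.
rewrite !lfun_appB !dual_rep_starE !dual_repE !lfun_appN !comp_lfunE.
rewrite /obstr !(lfunD, lfunN).
ring.
Qed.

End CheckMinus.

(** * Components of the equations and the six identities *)

Section Obstruction.

Variables (k : fieldType) (A : novikovType k) (V : vectType k).
Variables (M : bimodule A V) (alpha : 'Hom(V, A)).

Local Notation l := (bl M).
Local Notation r := (br M).
Local Notation B := (obstr M alpha).
Local Notation P := (check_minus M alpha).
Local Notation N := (ybform P).
Implicit Types (p : dual A) (u v w : V) (x : A).

Lemma obstrDl u u' v : B (u + u') v = B u v + B u' v.
Proof.
apply: dual_inj => p; rewrite /obstr -!RmulE !(lfunD, lfunN) [l (_ + _)]linearD.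
rewrite lfun_appD !lfunD; ring.
Qed.

Lemma obstrDr u v v' : B u (v + v') = B u v + B u v'.
Proof.
apply: dual_inj => p; rewrite /obstr -!LmulE !(lfunD, lfunN) [r (_ + _)]linearD.
rewrite lfun_appD !lfunD; ring.
Qed.

Lemma obstrNl u v : B (- u) v = - B u v.
Proof.
have B0 : B 0 v = 0 by apply: (addrI (B 0 v)); rewrite -obstrDl !addr0.
by apply/eqP; rewrite -addr_eq0 -obstrDl addNr B0.
Qed.

Lemma obstrNr u v : B u (- v) = - B u v.
Proof.
have B0 : B u 0 = 0 by apply: (addrI (B u 0)); rewrite -obstrDr !addr0.
by apply/eqP; rewrite -addr_eq0 -obstrDr addNr B0.
Qed.

(** The four forms vary independently, so all but one can be set to zero. *)
Lemma dual_sum_eq0 (a b c : A) v :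
  (forall (sg rh pi : dual A) (f : dual V), sg a + rh b + pi c + f v = 0) <->
  [/\ a = 0, b = 0, c = 0 & v = 0].
Proof.
split=> [E|[-> -> -> ->] sg rh pi f]; last by rewrite !lfun0 !addr0.
by split; apply: dual_inj => p; rewrite lfun0;
  [ have := E p 0 0 0 | have := E 0 p 0 0
  | have := E 0 0 p 0 | have := E 0 0 0 p ];
  rewrite !zero_lfunE ?add0r ?addr0.
Qed.

Let Lmul_coefE (p : dual A) f x u y :
  (p \o Lmul x + matcoef r f u)%VF y = p (x ∘ y) + f (r y u).
Proof. by rewrite lfun_appD comp_lfunE LmulE matcoefE. Qed.

Let Lstar_coefE (p : dual A) f x u y :
  (p \o Lstar x - matcoef l f u)%VF y = p (x ⋆ y) - f (l y u).
Proof. by rewrite lfun_appB comp_lfunE LstarE matcoefE. Qed.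

(** Each list holds the coefficients of [sg], [rh], [pi] and [f]: the first list for the second
    equation, the second list for the first equation. *)
Definition gnybe_components (b : V -> V -> A) u v w x : Prop :=
  [/\ b (l x w) v - b (l x v) w = 0,
      x ⋆ b u w - (b (l x w) u + b u (l x w)) = 0,
      b u (l x v) + b (l x v) u - x ⋆ b u v = 0 &
      l (b u v) w - l (b u w) v = 0] /\
  [/\ b (l x w) v *+ 2 + b v (l x w) - b (l x v + r x v) w - x ∘ b v w = 0,
      x ∘ b u w + b (l x u + r x u) w - b (l x w) u *+ 2 - b u (l x w) = 0,
      b u (l x v + r x v) + b (l x v + r x v) u + x ⋆ b v u
        - b (l x u + r x u) v - b v (l x u + r x u) - x ⋆ b u v = 0 &
      r (b u w) v - l (b v u) w - r (b v w) u + l (b u v) w = 0].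

(** At [a = (x, f)] and three forms [sdfun], each equation is a sum of values of [sg], [rh], [pi]
    and [f], so it splits by [dual_sum_eq0]; the converse uses that every form on [S] is some
    [sdfun]. *)
Lemma gnybes_check_minusP : gnybes P <->
  forall u v w x, gnybe_components B u v w x.
Proof.
pose S := dual_semidirect M.
have E1 sg u rh v pi w x f :
  let p := sdfun M sg u in let q := sdfun M rh v in let s := sdfun M pi w in
  let a := ((x, f) : S) in
  (N p s (q \o Lmul a)%VF + N q p (s \o Lstar a)%VF)
  - (N (p \o Lmul a)%VF s q + N p q (s \o Lstar a)%VF)
  = sg (B (l x w) v *+ 2 + B v (l x w) - B (l x v + r x v) w - x ∘ B v w)
    + rh (x ∘ B u w + B (l x u + r x u) w - B (l x w) u *+ 2 - B u (l x w))
    + pi (B u (l x v + r x v) + B (l x v + r x v) u + x ⋆ B v u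
        - B (l x u + r x u) v - B v (l x u + r x u) - x ⋆ B u v)
    + f (r (B u w) v - l (B v u) w - r (B v w) u + l (B u v) w).
  rewrite /= !sdfun_Lmul !sdfun_Lstar !ybform_check_minus.
  rewrite !(Lmul_coefE, Lstar_coefE) !(obstrNl, obstrNr) !mulr2n.
  by move: B => b; rewrite !(lfunD, lfunN); ring.
have E2 sg u rh v pi w x f :
  let p := sdfun M sg u in let q := sdfun M rh v in let s := sdfun M pi w in
  let a := ((x, f) : S) in
  N p s (q \o Lstar a)%VF - N p q (s \o Lstar a)%VF
  = sg (B (l x w) v - B (l x v) w)
    + rh (x ⋆ B u w - (B (l x w) u + B u (l x w)))
    + pi (B u (l x v) + B (l x v) u - x ⋆ B u v)
    + f (l (B u v) w - l (B u w) v).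
  rewrite /= !sdfun_Lstar !ybform_check_minus !Lstar_coefE !(obstrNl, obstrNr).
  by move: B => b; rewrite !(lfunD, lfunN); ring.
split=> [/(gnybesP (check_minus_skew M alpha)) E u v w x|E].
  split; apply/dual_sum_eq0 => sg rh pi f.
    rewrite -(E2 sg u rh v pi w x f) /=.
    apply/eqP; rewrite subr_eq0; apply/eqP.
    exact: (E (x, f) (sdfun M sg u) (sdfun M rh v) (sdfun M pi w)).2.
  rewrite -(E1 sg u rh v pi w x f) /=.
  apply/eqP; rewrite subr_eq0; apply/eqP.
  exact: (E (x, f) (sdfun M sg u) (sdfun M rh v) (sdfun M pi w)).1.
apply/(gnybesP (check_minus_skew M alpha)) => -[x f] p q s.
have [sg [u ->]] := sdfun_surj p; have [rh [v ->]] := sdfun_surj q.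
have [pi [w ->]] := sdfun_surj s; have [F1 F2] := E u v w x.
split; apply/eqP; rewrite -subr_eq0; apply/eqP.
  by rewrite (E1 sg u rh v pi w x f); exact: ((dual_sum_eq0 _ _ _ _).2 F2).
by rewrite (E2 sg u rh v pi w x f); exact: ((dual_sum_eq0 _ _ _ _).2 F1).
Qed.

(** Modulo the fourth identity, the first two components of the second list are, up to sign, the
    fifth identity for [v] and for [u]. Modulo the third, the third component of that list is the
    sixth up to sign. The other components restate the first four identities, the third one
    twice. *)
Lemma gnybe_componentsP (b : V -> V -> A)
    (bDl : forall u u' v, b (u + u') v = b u v + b u' v)
    (bDr : forall u v v', b u (v + v') = b u v + b u v') :
  (forall u v w x, gnybe_components b u v w x) <->
  (forall u v w x,
    l (b u v) w = l (b u w) v /\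
    l (b u v) w - l (b v u) w = r (b v w) u - r (b u w) v /\
    x ⋆ b u w = b (l x w) u + b u (l x w) /\
    b (l x w) v = b (l x v) w /\
    b (l x w) u + b u (l x w) = x ∘ b u w + b (r x u) w /\
    b (r x u) v + b v (r x u) = b (r x v) u + b u (r x v)).
Proof.
have sub0 (U : vectType k) (y z : U) : y - z = 0 -> y = z.
  by move/eqP; rewrite subr_eq0 => /eqP.
split=> E u v w x.
  have [[e4 e3 _ e1] [_ e5 e6 e2]] := E u v w x.
  have [[e4' _ _ _] _] := E u u w x.
  have [[_ e3u _ _] _] := E v u u x; have [[_ e3v _ _] _] := E u v v x.
  (* The first, third and fourth identities are components as they stand; the second, fifth and
     sixth remain and are tested on forms, which makes them scalar. *)
  do !split; apply: sub0 => //; apply: dual_inj => p; rewrite lfun0.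
  - have := congr1 p e2; rewrite !(lfunD, lfunN) lfun0 => h.
    by rewrite -[RHS]h; ring.
  - have := congr1 p e5; have := congr1 p e4'.
    rewrite !bDl !mulr2n !(lfunD, lfunN) lfun0 => h4 h5.
    (* Zero is rewritten as minus the left side of [h5] minus that of [h4]. *)
    rewrite -[RHS]subr0 -[X in _ = X - _]oppr0.
    rewrite -[X in _ = _ - X]h4 -[X in _ = - X - _]h5.
    ring.
  - have := congr1 p e6; have := congr1 p e3u; have := congr1 p e3v.
    rewrite !(bDl, bDr) !(lfunD, lfunN) lfun0 => hv hu h6.
    (* Zero becomes the left side of [hu] minus those of [hv] and [h6], so that the terms in [⋆] and
       in [l] cancel. *)
    rewrite -[RHS]subr0 -[X in _ = X - _]subr0 -[X in _ = _ - X]h6.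
    rewrite -[X in _ = X - _ - _]hu -[X in _ = _ - X - _]hv.
    ring.
have [e1 [e2 [e3 [e4 [e5 e6]]]]] := E u v w x.
(* These instances of the third identity evaluate [x ⋆ b u v] and [x ⋆ b v u] for the components in
   [pi]. *)
have [_ [_ [e3uv _]]] := E u w v x; have [_ [_ [e3vu _]]] := E v w u x.
have [_ [_ [_ [e4u _]]]] := E u u w x; have [_ [_ [_ [_ [e5v _]]]]] := E v u w x.
split; split; apply: dual_inj => p; rewrite lfun0.
- by rewrite e4 subrr lfun0.
- by rewrite e3 subrr lfun0.
- by rewrite e3uv [X in X - _]addrC subrr lfun0.
- by rewrite e1 subrr lfun0.
- have := congr1 p e5v; have := congr1 p e4.
  rewrite !bDl !mulr2n !(lfunD, lfunN) => h4.
  rewrite -h4 => h5.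
  have -> : p (x ∘ b v w) = p (b (l x w) v) + p (b v (l x w)) - p (b (r x v) w).
    by rewrite h5 addrK.
  ring.
- have := congr1 p e5; have := congr1 p e4u.
  rewrite !bDl !mulr2n !(lfunD, lfunN) => h4 h5.
  have -> : p (x ∘ b u w) = p (b (l x w) u) + p (b u (l x w)) - p (b (r x u) w).
    by rewrite h5 addrK.
  by rewrite h4; ring.
- have := congr1 p e6; rewrite e3uv e3vu !(bDl, bDr) !(lfunD, lfunN) => /eqP.
  rewrite eq_sym -subr_eq => /eqP <-.
  ring.
- have := congr1 p e2; rewrite !(lfunD, lfunN) => /eqP.
  rewrite subr_eq => /eqP ->.
  ring.
Qed.

End Obstruction.

Theorem theorem4p8 (k : fieldType) (chark : [pchar k] =i pred0)
    (A : novikovType k) (V : vectType k) (M : bimodule A V)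
    (alpha : 'Hom(V, A)) :
  let l := bl M in
  let r := br M in
  let B := obstr M alpha in
  let P := check_minus M alpha in
  (skew_symmetric P /\ gnybes P) <->
  (forall (u v w : V) (x : A),
    l (B u v) w = l (B u w) v /\
    l (B u v) w - l (B v u) w = r (B v w) u - r (B u w) v /\
    x ⋆ B u w = B (l x w) u + B u (l x w) /\
    B (l x w) v = B (l x v) w /\
    B (l x w) u + B u (l x w) = x ∘ B u w + B (r x u) w /\
    B (r x u) v + B v (r x u) = B (r x v) u + B u (r x v)).
Proof.
move=> l r B P.
have components := gnybe_componentsP M (obstrDl M alpha) (obstrDr M alpha).
split=> [[_ /gnybes_check_minusP /components] //|E].
by split; [apply: check_minus_skew | apply/gnybes_check_minusP/components].
Qed.
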